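(* Let $K$ be a field and $\overline{K}$ an algebraic closure of $K$. Let $f(x)$ be a $1$-regular doubly monic polynomial of degree $n$ with coefficients in $K$. If $n>3$, then $f(x)$ is $2$-regular over $K$ if and only if there is no polynomial $g(x)$ of degree $2$ with coefficients in $\overline{K}$ which divides both $f(x)$ and $f^*(x)$ (in $\overline{K}[x]$).
   Context: Let $K$ be a field with algebraic closure $\overline{K}$, and let $f(x)\in K[x]$ be monic of degree $n$ with roots $\alpha_1,\ldots,\alpha_n\in\overline{K}$ listed with multiplicity. For an integer $k$ with $1\le k\le [n/2]$, $f$ is called $k$-regular over $K$ if $\alpha_{i_1}\cdots\alpha_{i_k}\neq 1$ for every $k$-tuple of integers with $1\le i_1<\cdots<i_k\le n$. (In particular $f$ is $1$-regular iff $f(1)\neq 0$.) A monic polynomial $f$ of degree $n$ is doubly monic if its constant term equals $(-1)^n$. For a doubly monic $f$ of degree $n$, its signed reciprocal polynomial is the doubly monic polynomial $f^*(x)=(-1)^n x^n f(x^{-1})$. *)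

(* Defs.v *)
From mathcomp Require Import all_boot all_order all_algebra.

Set Implicit Arguments.
Unset Strict Implicit.
Unset Printing Implicit Defensive.

Import GRing.Theory.
Local Open Scope ring_scope.

Definition degree (R : nzRingType) (f : {poly R}) : nat := (size f).-1.

(* [closedFieldType] already says that [L] is algebraically closed, so only
   algebraicity over [K] has to be added. *)
Definition is_algebraic_closure (K : fieldType) (L : closedFieldType)
    (iota : {rmorphism K -> L}) : Prop :=
  forall x : L, algebraicOver iota x.

Definition is_root_list (K : fieldType) (L : closedFieldType)
    (iota : {rmorphism K -> L}) (f : {poly K}) (n : nat)
    (alpha : 'I_n -> L) : Prop :=
  map_poly iota f = \prod_(i < n) ('X - (alpha i)%:P).

(* Meant for a monic [f] and 1 <= k <= (degree f)./2.  The quantification over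
   [alpha] makes the notion independent of the order in which the roots are
   listed; it is not vacuous, by [root_list_exists]. *)
Definition k_regular (K : fieldType) (L : closedFieldType)
    (iota : {rmorphism K -> L}) (k : nat) (f : {poly K}) : Prop :=
  forall alpha : 'I_(degree f) -> L, is_root_list iota f alpha ->
  forall i : 'I_k -> 'I_(degree f), {homo i : a b / (a < b)%N} ->
  \prod_(j < k) alpha (i j) != 1.

Definition doubly_monic (R : nzRingType) (f : {poly R}) : Prop :=
  f \is monic /\ f`_0 = (-1) ^+ degree f.

(* [(-1)^n x^n f(1/x)] written on coefficients; see [signed_reciprocalE]. *)
Definition signed_reciprocal (R : nzRingType) (f : {poly R}) : {poly R} :=
  (-1) ^+ degree f *: \poly_(i < (degree f).+1) f`_(degree f - i).

Lemma root_list_exists (K : fieldType) (L : closedFieldType)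
    (iota : {rmorphism K -> L}) (f : {poly K}) :
  f \is monic -> exists alpha : 'I_(degree f) -> L, is_root_list iota f alpha.
Proof.
move=> fmon; have [r rE] := closed_field_poly_normal (map_poly iota f).
move: rE; rewrite (monicP (monic_map iota fmon)) scale1r => rE.
have sr : size r = degree f.
  by rewrite /degree -(size_map_poly iota f) rE size_prod_XsubC.
exists (fun i => r`_i); rewrite /is_root_list rE (big_nth 0) sr.
by rewrite big_mkord.
Qed.

Lemma signed_reciprocalE (K : fieldType) (f : {poly K}) (x : K) : x != 0 ->
  (signed_reciprocal f).[x] = (-1) ^+ degree f * x ^+ degree f * f.[x^-1].
Proof.
move=> x0; rewrite /signed_reciprocal hornerZ horner_poly -mulrA.
congr (_ * _); rewrite (@horner_coef_wide _ (degree f).+1 f) ?leqSpred //.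
rewrite mulr_sumr (reindex_inj rev_ord_inj); apply: eq_bigr => i _ /=.
have le_i : (i <= degree f)%N by rewrite -ltnS.
rewrite subSS subKn // mulrCA; congr (_ * _).
by rewrite exprVn -[X in _ = x ^+ X / _](subnK le_i) exprD mulfK // expf_neq0.
Qed.

(* Main.v *)
(* If alpha_1, ..., alpha_n are the roots of f, then alpha_1 ... alpha_n = 1
   makes f^* the product of the X - alpha_i^-1.  A pair i != j with
   alpha_i alpha_j = 1 yields the common factor (X - alpha_i)(X - alpha_j).
   Conversely, let (X - a)(X - b) divide f and f^*.  Then a, b, a^-1, b^-1 are
   roots of f; if a != a^-1 or b != b^-1 these give a pair of product 1, and
   otherwise a = b = -1 by 1-regularity, so that -1 is a double root of f. *)
Require Import Defs.
From mathcomp Require Import all_boot all_order all_algebra.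

Set Implicit Arguments.
Unset Strict Implicit.
Unset Printing Implicit Defensive.

Import GRing.Theory.
Local Open Scope ring_scope.

Lemma k_regular1P (K : fieldType) (L : closedFieldType)
    (iota : {rmorphism K -> L}) (f : {poly K}) :
  k_regular iota 1 f <->
  (forall alpha : 'I_(degree f) -> L, is_root_list iota f alpha ->
   forall i, alpha i != 1).
Proof.
split=> [reg alpha ha i | reg alpha ha i _]; last first.
  by rewrite big_ord1; apply: reg.
have := reg alpha ha (fun=> i); rewrite big_ord1; apply=> j k.
by rewrite !ord1.
Qed.

(** Increasing pairs may be replaced by pairs of distinct indices because the product is
    commutative. *)
Lemma k_regular2P (K : fieldType) (L : closedFieldType)
    (iota : {rmorphism K -> L}) (f : {poly K}) :
  k_regular iota 2 f <->
  (forall alpha : 'I_(degree f) -> L, is_root_list iota f alpha ->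
   forall i j, i != j -> alpha i * alpha j != 1).
Proof.
split=> [reg alpha ha | reg alpha ha s s_incr]; last first.
  rewrite big_ord_recl big_ord1; apply: reg => //.
  by rewrite -val_eqE neq_ltn s_incr.
have reg_lt (i j : 'I_(degree f)) : (i < j)%N -> alpha i * alpha j != 1.
  move=> ltij; pose s (k : 'I_2) := if k == ord0 then i else j.
  have := reg alpha ha s; rewrite big_ord_recl big_ord1 /s /=; apply.
  (* Among the four pairs in ['I_2], only (0, 1) is increasing, and there the claim is [i < j]. *)
  by case=> [[|[|//]] ?] [[|[|//]] ?].
move=> i j; rewrite -val_eqE neq_ltn => /orP[|/reg_lt] //; first exact: reg_lt.
by rewrite mulrC.
Qed.

(** Multiplicity is carried by the indices: cancelling the factor at [i] leaves the product over the
    other indices, so the root [b] is found at some [j != i] even when [a = b]. *)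
Lemma dvdp_XsubC2_prod (F : fieldType) (I : finType) (alpha : I -> F)
    (a b : F) :
  reflect (exists i j, [/\ i != j, alpha i = a & alpha j = b])
    (('X - a%:P) * ('X - b%:P) %| \prod_i ('X - (alpha i)%:P)).
Proof.
have root_prod (P : pred I) c : root (\prod_(i | P i) ('X - (alpha i)%:P)) c ->
    exists2 i, P i & alpha i = c.
  rewrite rootE horner_prod => /prodf_eq0[i Pi].
  by rewrite hornerXsubC subr_eq0 => /eqP ->; exists i.
apply: (iffP idP) => [ab_dvd | [i [j [neq_ij <- <-]]]]; last first.
  rewrite (bigD1 i) //= dvdp_mul2l ?polyXsubC_eq0 //.
  by rewrite (bigD1 j) 1?eq_sym // dvdp_mulr.
have [|i _ ai] := root_prod xpredT a.
  by rewrite -dvdp_XsubCl; apply: dvdp_trans ab_dvd; rewrite dvdp_mulr.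
move: ab_dvd; rewrite (bigD1 i) //= ai dvdp_mul2l ?polyXsubC_eq0 //.
rewrite dvdp_XsubCl => /root_prod[j neq_ji aj].
by exists i, j; rewrite eq_sym.
Qed.

Lemma closed_poly_size3 (L : closedFieldType) (g : {poly L}) :
  size g = 3%N -> exists a b, ('X - a%:P) * ('X - b%:P) %| g.
Proof.
move=> sg; have [r gE] := closed_field_poly_normal g.
have nz : lead_coef g != 0 by rewrite lead_coef_eq0 -size_poly_eq0 sg.
have : size r = 2%N.
  by apply/succn_inj; rewrite -sg gE size_scale // size_prod_XsubC.
case: r gE => [|a [|b []]] //= gE _; exists a, b.
by rewrite gE dvdpZr // !big_cons big_nil mulr1.
Qed.

Lemma closed_poly_eq_nonzero (L : closedFieldType) (p q : {poly L}) :
  (forall x, x != 0 -> p.[x] = q.[x]) -> p = q.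
Proof.
move=> eq_pq; apply/eqP; rewrite -subr_eq0; apply: contraT => nz.
(* 'X * (p - q) + 1 takes only the value 1, so it has no root. *)
have : size ('X * (p - q) + 1) != 1%N.
  rewrite mulrC size_polyDl size_mulX ?size_poly1 //.
    by rewrite eqSS size_poly_eq0.
  by rewrite ltnS lt0n size_poly_eq0.
case/closed_rootP=> x; rewrite rootE !hornerE.
have [-> | x0] := eqVneq x 0; first by rewrite mul0r add0r oner_eq0.
by rewrite eq_pq // subrr mulr0 add0r oner_eq0.
Qed.

Lemma map_signed_reciprocal (K L : fieldType) (iota : {rmorphism K -> L})
    (f : {poly K}) :
  map_poly iota (signed_reciprocal f) = signed_reciprocal (map_poly iota f).
Proof.
apply/polyP=> i; rewrite /signed_reciprocal /degree size_map_poly.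
rewrite coef_map /= !coefZ 2!coef_poly rmorphM rmorph_sign.
by case: ifP; rewrite ?coef_map ?rmorph0.
Qed.

(** Both sides, multiplied by (-1)^n, are the constant term of [f] in [L]. *)
Lemma prod_root_list (K : fieldType) (L : closedFieldType)
    (iota : {rmorphism K -> L}) (f : {poly K})
    (alpha : 'I_(degree f) -> L) :
  doubly_monic f -> is_root_list iota f alpha -> \prod_i alpha i = 1.
Proof.
case=> _ f0 ha; apply: (@mulfI _ ((-1) ^+ degree f)).
  by rewrite signr_eq0.
rewrite mulr1 -[RHS](rmorph_sign iota) -f0 -coef_map ha.
rewrite -horner_coef0 horner_prod -[X in _ ^+ X * _]card_ord -prodrN.
by apply: eq_bigr => i _; rewrite hornerXsubC sub0r.
Qed.

Lemma root_list_neq0 (K : fieldType) (L : closedFieldType)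
    (iota : {rmorphism K -> L}) (f : {poly K})
    (alpha : 'I_(degree f) -> L) :
  doubly_monic f -> is_root_list iota f alpha -> forall i, alpha i != 0.
Proof.
move=> dm ha i.
by have := oner_neq0 L; rewrite -(prod_root_list dm ha) => /prodf_neq0; apply.
Qed.

Lemma signed_reciprocal_root_list (K : fieldType) (L : closedFieldType)
    (iota : {rmorphism K -> L}) (f : {poly K})
    (alpha : 'I_(degree f) -> L) :
  doubly_monic f -> is_root_list iota f alpha ->
  map_poly iota (signed_reciprocal f) = \prod_i ('X - (alpha i)^-1%:P).
Proof.
move=> dm ha; have a1 := prod_root_list dm ha.
have nz := root_list_neq0 dm ha.
(* Evaluation at nonzero points suffices, and this is where [signed_reciprocalE] applies. *)
apply: closed_poly_eq_nonzero => x x0.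
rewrite map_signed_reciprocal signed_reciprocalE // -exprMn_comm; last first.
  exact: mulrC.
rewrite {1}/degree size_map_poly -/(degree f) ha !horner_prod.
have -> : (-1 * x) ^+ degree f = \prod_(i < degree f) (-1 * x).
  by rewrite prodr_const card_ord.
(* Writing 1 as the product of the roots a makes the identity hold factor by factor: -x (1/x - a) =
   a (x - 1/a). *)
rewrite -[RHS]mul1r -[X in _ = X * _]a1 -!big_split /=; apply: eq_bigr => i _.
by rewrite !hornerXsubC !mulrBr mulN1r !mulNr !divff // opprK mulrC addrC.
Qed.

Theorem theorem2p15 (K : fieldType) (L : closedFieldType)
    (iota : {rmorphism K -> L}) (hL : is_algebraic_closure iota)
    (f : {poly K}) (n : nat) (hdeg : degree f = n)
    (hdm : doubly_monic f) (hreg : k_regular iota 1 f) (hn : (3 < n)%N) :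
  k_regular iota 2 f <->
  ~ (exists g : {poly L},
       [/\ degree g = 2%N,
           g %| map_poly iota f
         & g %| map_poly iota (signed_reciprocal f)]).
Proof.
have reg1 := (k_regular1P iota f).1 hreg.
split=> [/k_regular2P reg2 [g [dg gf gf']] | no_g].
  have [alpha ha] := root_list_exists iota hdm.1.
  have [|a [b ab_g]] := @closed_poly_size3 L g.
    by move: dg; rewrite /degree; case: (size g) => //= m ->.
  have := dvdp_trans ab_g gf; rewrite ha.
  case/dvdp_XsubC2_prod=> i [j [neq_ij ai aj]].
  have := dvdp_trans ab_g gf'; rewrite (signed_reciprocal_root_list hdm ha).
  case/dvdp_XsubC2_prod=> i' [j' [_ ai' aj']].
  have nz := root_list_neq0 hdm ha.
  (* A root whose inverse is also a root: 2-regularity forces the two indices to coincide, so the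
     root squares to 1, and 1-regularity excludes 1. *)
  have rootN1 k k' : (alpha k')^-1 = alpha k -> alpha k = -1.
    move=> inv_k; have kk' : alpha k * alpha k' = 1 by rewrite -inv_k mulVf.
    have [eq_kk' | /(reg2 _ ha)] := eqVneq k k'; last by rewrite kk' eqxx.
    move/eqP: kk'; rewrite -eq_kk' -expr2 sqrf_eq1 (negPf (reg1 _ ha k)) /=.
    by move/eqP.
  (* Both [a] and [b] are -1, at distinct indices, and (-1)(-1) = 1 contradicts 2-regularity. *)
  have /eqP[] := reg2 _ ha i j neq_ij.
  rewrite (rootN1 i i') ?ai // (rootN1 j j') ?aj //.
  by rewrite mulrNN mulr1.
apply/k_regular2P=> alpha ha i j neq_ij; apply/eqP=> aij; apply: no_g.
exists (('X - (alpha i)%:P) * ('X - (alpha j)%:P)); split.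
- by rewrite /degree size_mul ?polyXsubC_eq0 // !size_XsubC.
- by rewrite ha; apply/dvdp_XsubC2_prod; exists i, j.
rewrite (signed_reciprocal_root_list hdm ha); apply/dvdp_XsubC2_prod.
(* The indices are swapped because inversion exchanges [alpha i] and [alpha j]. *)
exists j, i; rewrite eq_sym neq_ij; split=> //; last exact: mulr1_eq.
by apply: mulr1_eq; rewrite mulrC.
Qed.
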